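(* Let $\mathbb{V}=U\oplus W$ be an $n$-dimensional vector space over a finite field $\mathcal{F}$ with $q$ elements, where $U$ and $W$ are nonzero subspaces, and let $\Gamma=\Gamma_{U\oplus W}(\mathbb{V})$ be the direct sum graph. Then: (i) If $n=2$, $\dim(W)=n-1$ and $q=2$, then $\Gamma$ is a trivial graph (a single vertex). (ii) If $n=2$, $\dim(W)=n-1$ and $q\neq 2$, then $\Gamma$ is triangulated. (iii) If $n=3$, $\dim(W)=n-1$ and $q=2$, then $\Gamma$ contains no cycle. (iv) If $n=3$, $\dim(W)=n-1$ and $q\neq 2$, then $\Gamma$ is triangulated. (v) If $n\geq 4$, $\dim(W)=n-1$ and $q\geq 2$, then $\Gamma$ is triangulated. (vi) If $n\geq 4$, $\dim(W)\leq n-2$ and $q\geq 2$, then $\Gamma$ is triangulated.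
   Context: Let $\dim U=r$, $\dim W=s$, $r+s=n$. Fix a basis $\{\alpha_1,\dots,\alpha_r\}$ of $U$ and a basis $\{\beta_1,\dots,\beta_s\}$ of $W$; every $x\in\mathbb{V}$ is written uniquely as $x=\sum_i a_i\alpha_i+\sum_j b_j\beta_j$. The direct sum graph $\Gamma_{U\oplus W}(\mathbb{V})$ is the simple graph whose vertex set is $\{x=u+w: u\in U, w\in W, u\neq 0, w\neq 0\}$, in which two distinct vertices $x,y$ are adjacent iff there is an index $i$ such that the coefficient of $\alpha_i$ is nonzero in both $x$ and $y$, and there is an index $j$ such that the coefficient of $\beta_j$ is nonzero in both $x$ and $y$. A graph is triangulated if every vertex lies in a triangle, i.e. for every vertex $u$ there exist vertices $v,w$ with $u,v,w$ pairwise adjacent. *)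

(* Defs.v *)
From HB Require Import structures.
From mathcomp Require Import all_boot all_order all_algebra all_field.
Set Implicit Arguments.
Unset Strict Implicit.
Unset Printing Implicit Defensive.
Import GRing.Theory.
Local Open Scope ring_scope.

Record sgraph := SGraph {
  vertex :> finType;
  adj : rel vertex;
  adj_sym : symmetric adj;
  adj_irr : irreflexive adj }.

Definition trivial_graph (G : sgraph) : Prop := #|G| = 1%N.

(* The three vertices are automatically distinct since adj is irreflexive. *)
Definition triangulated (G : sgraph) : Prop :=
  forall u : G, exists v w : G, [/\ adj u v, adj v w & adj u w].

(* ucycle: consecutive vertices adjacent (last to first included), all vertices
   distinct; a cycle of a simple graph has length at least 3. *)
Definition is_cycle (G : sgraph) (c : seq G) : Prop :=
  ucycle (@adj G) c /\ (2 < size c)%N.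

Definition contains_no_cycle (G : sgraph) : Prop :=
  forall c : seq G, ~ is_cycle c.

Section DirectSumGraph.

Variables (F : finFieldType) (V : vectType F) (r s : nat).
Variables (U W : {vspace V}) (alpha : r.-tuple V) (beta : s.-tuple V).

(* Meaningful when alpha ++ beta is a basis of V; coord only sees linear
   combinations of a free family. *)
Definition alpha_coef (x : V) (i : 'I_r) : F :=
  coord [tuple of alpha ++ beta] (lshift s i) x.
Definition beta_coef (x : V) (j : 'I_s) : F :=
  coord [tuple of alpha ++ beta] (rshift r j) x.

(* finvect_type V is V itself, equipped with its finType structure. *)
Definition dsg_vertices : {set finvect_type V} :=
  [set x | [exists u : finvect_type V, exists w : finvect_type V,
             [&& u \in U, w \in W, u != 0, w != 0 & x == u + w]]].

Definition dsg_vertex : finType := {x : finvect_type V | x \in dsg_vertices}.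

Definition dsg_adj : rel dsg_vertex := fun x y =>
  [&& x != y,
      [exists i : 'I_r, (alpha_coef (val x) i != 0)
                     && (alpha_coef (val y) i != 0)]
    & [exists j : 'I_s, (beta_coef (val x) j != 0)
                     && (beta_coef (val y) j != 0)]].

Lemma dsg_adj_sym : symmetric dsg_adj.
Proof.
move=> x y; rewrite /dsg_adj eq_sym.
by congr [&& _, _ & _]; apply: eq_existsb => i; rewrite andbC.
Qed.

Lemma dsg_adj_irr : irreflexive dsg_adj.
Proof. by move=> x; rewrite /dsg_adj eqxx. Qed.

Definition direct_sum_graph : sgraph := SGraph dsg_adj_sym dsg_adj_irr.

End DirectSumGraph.

(* Main.v *)
(** Every vertex has some nonzero alpha-coefficient i and some nonzero
    beta-coefficient j, and the vertices whose i-th alpha- and j-th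
    beta-coefficients are both nonzero form a clique.  This clique has
    (q - 1)^2 q^(n - 2) elements, hence at least three as soon as q > 2 or
    n > 3.  Over the field with two elements the remaining cases are n = 2,
    with a single vertex, and n = 3, where the three vertices form a path. *)
Require Import Defs.
From HB Require Import structures.
From mathcomp Require Import all_boot all_order all_algebra all_field.
Set Implicit Arguments.
Unset Strict Implicit.
Unset Printing Implicit Defensive.
Import GRing.Theory.
Local Open Scope ring_scope.

Lemma card2_eq_neq0 (F : finFieldType) (a b : F) :
  #|F| = 2%N -> a != 0 -> b != 0 -> a = b.
Proof.
move=> F2 a0 b0; apply/eqP/negP => /negP nab.
have := max_card (mem [set 0; a; b]).
rewrite F2 -setUA cardsU1 cards2 !inE.
by rewrite (negbTE nab) (eq_sym 0 a) (eq_sym 0 b) (negbTE a0) (negbTE b0).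
Qed.

Lemma ex_scalar_neq01 (F : finFieldType) :
  (2 < #|F|)%N -> exists t : F, t != 0 /\ t != 1.
Proof.
move=> F3; have /card_gt0P[t] : (0 < #|~: [set 0%R; 1%R : F]|)%N.
  by rewrite cardsCs setCK cards2 subn_gt0 (leq_trans _ F3) // ltnS; case: eqP.
by rewrite !inE negb_or => /andP[t0 t1]; exists t.
Qed.

Section DirectSumCoefficients.

Variables (F : finFieldType) (V : vectType F) (r s : nat).
Variables (U W : {vspace V}) (alpha : r.-tuple V) (beta : s.-tuple V).
Hypotheses (hsum : (U + W)%VS = fullv) (hdirect : directv (U + W)).
Hypotheses (halpha : basis_of U alpha) (hbeta : basis_of W beta).

Local Notation B := [tuple of alpha ++ beta].
Local Notation G := (direct_sum_graph U W alpha beta).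

Lemma cat_basis_fullv : basis_of fullv B.
Proof. by rewrite -hsum; apply: cat_basis. Qed.

Lemma alpha_beta_decomp (x : V) :
  x = \sum_i alpha_coef alpha beta x i *: alpha`_i
    + \sum_j beta_coef alpha beta x j *: beta`_j.
Proof.
rewrite {1}(coord_basis cat_basis_fullv (memvf x)) big_split_ord /=.
congr (_ + _); apply: eq_bigr => i _; congr (_ *: _); rewrite nth_cat size_tuple.
  by rewrite ltn_ord.
by rewrite ltnNge leq_addr /= addKn.
Qed.

Lemma alpha_sum_mem (a : 'I_r -> F) : \sum_i a i *: alpha`_i \in U.
Proof.
apply: memv_suml => i _; apply/memvZ/(basis_mem halpha)/mem_nth.
by rewrite size_tuple.
Qed.

Lemma beta_sum_mem (b : 'I_s -> F) : \sum_j b j *: beta`_j \in W.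
Proof.
apply: memv_suml => i _; apply/memvZ/(basis_mem hbeta)/mem_nth.
by rewrite size_tuple.
Qed.

Lemma coef_inj (x y : V) :
    alpha_coef alpha beta x =1 alpha_coef alpha beta y ->
    beta_coef alpha beta x =1 beta_coef alpha beta y ->
  x = y.
Proof.
move=> exy fxy; rewrite (alpha_beta_decomp x) (alpha_beta_decomp y).
by congr (_ + _); apply: eq_bigr => i _; rewrite ?exy ?fxy.
Qed.

Lemma mem_capv_eq0 (x : V) : x \in U -> x \in W -> x = 0.
Proof.
move=> xU xW; apply/eqP; rewrite -memv0 -(directv_addP hdirect).
by rewrite memv_cap xU.
Qed.

Lemma dsg_verticesP (x : finvect_type V) :
  reflect ((exists i, alpha_coef alpha beta x i != 0)
           /\ (exists j, beta_coef alpha beta x j != 0))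
          (x \in dsg_vertices U W).
Proof.
rewrite inE; apply: (iffP idP) => [|[[i ai0] [j bj0]]].
  (* If all alpha-coefficients of [x] vanished, then [x], and with it [u = x - w], would lie in [W],
     which forces [u] into the intersection of [U] and [W], that is [u = 0]. The beta half exchanges
     the roles of [U] and [W]. *)
  case/existsP=> u /existsP[w /and5P[uU wW u0 w0 /eqP xE]].
  split; apply/existsP; apply: contraT.
    rewrite negb_exists => /forallP a0; case/eqP: u0.
    apply: mem_capv_eq0 => //; have -> : (u : V) = x - w by rewrite xE addrK.
    rewrite rpredB // (alpha_beta_decomp x) big1 ?add0r ?beta_sum_mem // => i _.
    by move: (a0 i) => /negPn /eqP ->; rewrite scale0r.
  rewrite negb_exists => /forallP b0; case/eqP: w0.
  apply: mem_capv_eq0 => //; have -> : (w : V) = x - u by rewrite xE addrC addKr.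
  rewrite rpredB // (alpha_beta_decomp x).
  rewrite [X in _ + X]big1 ?addr0 ?alpha_sum_mem // => i _.
  by move: (b0 i) => /negPn /eqP ->; rewrite scale0r.
(* Conversely, the alpha-part and the beta-part of [x] serve as [u] and [w]; freeness of each basis
   turns one nonzero coefficient into a nonzero vector. *)
apply/existsP; exists (\sum_i alpha_coef alpha beta x i *: alpha`_i).
apply/existsP; exists (\sum_j beta_coef alpha beta x j *: beta`_j).
apply/and5P; split; rewrite ?alpha_sum_mem ?beta_sum_mem //.
- apply: contraNneq ai0 => /(congr1 (coord alpha i)).
  by rewrite coord_sum_free ?(basis_free halpha) // linear0 => ->.
- apply: contraNneq bj0 => /(congr1 (coord beta j)).
  by rewrite coord_sum_free ?(basis_free hbeta) // linear0 => ->.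
- by apply/eqP; apply: alpha_beta_decomp.
Qed.

Lemma coord_bump (x : V) d (k l : 'I_(r + s)) :
  coord B l (x + d *: B`_k) = coord B l x + d * (k == l)%:R.
Proof.
by rewrite linearD linearZ /= coord_free ?(basis_free cat_basis_fullv).
Qed.

(** The triangle is [x] with two translates of it along distinct basis vectors. Distinct directions
    keep the three vectors different, and the condition on [l] keeps the coefficients [i] and [j]
    nonzero in all of them, which gives both membership in the vertex set and adjacency. *)
Lemma dsg_triangulated :
    (forall (x : V) i j,
       alpha_coef alpha beta x i != 0 -> beta_coef alpha beta x j != 0 ->
     exists (k1 k2 : 'I_(r + s)) (d1 d2 : F), [/\ k1 != k2, d1 != 0, d2 != 0 &
       forall l : 'I_(r + s), l \in [:: lshift s i; rshift r j] ->
         coord B l (x + d1 *: B`_k1) != 0 /\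
         coord B l (x + d2 *: B`_k2) != 0]) ->
  triangulated G.
Proof.
move=> ext [x xG]; have /dsg_verticesP[[i xi] [j xj]] := xG.
have [k1 [k2 [d1 [d2 [k12 d10 d20 nz]]]]] := ext x i j xi xj.
have [|yi zi] := nz (lshift s i); first by rewrite inE eqxx.
have [|yj zj] := nz (rshift r j); first by rewrite !inE eqxx orbT.
set y : finvect_type V := x + d1 *: B`_k1 in yi yj.
set z : finvect_type V := x + d2 *: B`_k2 in zi zj.
have yG : y \in dsg_vertices U W by apply/dsg_verticesP; split; [exists i|exists j].
have zG : z \in dsg_vertices U W by apply/dsg_verticesP; split; [exists i|exists j].
have xy : x != y.
  apply/eqP => /(congr1 (fun v : V => coord B k1 v)); rewrite coord_bump eqxx mulr1.
  by move/eqP; rewrite -subr_eq0 opprD addNKr oppr_eq0 (negbTE d10).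
have xz : x != z.
  apply/eqP => /(congr1 (fun v : V => coord B k2 v)); rewrite coord_bump eqxx mulr1.
  by move/eqP; rewrite -subr_eq0 opprD addNKr oppr_eq0 (negbTE d20).
(* Only [y] was moved along the basis vector [k1], so that coordinate separates the two. *)
have yz : y != z.
  apply/eqP => /(congr1 (fun v : V => coord B k1 v)).
  rewrite !coord_bump eqxx mulr1 (eq_sym k2) (negbTE k12) mulr0.
  by move/addrI/eqP; rewrite (negbTE d10).
exists (Sub y yG), (Sub z zG); rewrite /= /dsg_adj -!val_eqE /=.
by split; apply/and3P; split=> //; apply/existsP;
  do [by exists i; apply/andP | by exists j; apply/andP].
Qed.

(** Adding [(t - 1) * a] to a coefficient [a] multiplies it by [t]: the result stays nonzero because
    [t != 0], and it changes because [t != 1]. One translate rescales coefficient [i], the other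
    coefficient [j]. *)
Lemma dsg_triangulated_card : (2 < #|F|)%N -> triangulated G.
Proof.
move=> /ex_scalar_neq01[t [t0 t1]]; apply: dsg_triangulated => x i j xi xj.
have nz a : a != 0 -> (t - 1) * a != 0 by move=> ?; rewrite mulf_neq0 ?subr_eq0.
have nz' a : a != 0 -> a + (t - 1) * a != 0.
  by move=> ?; rewrite mulrBl mul1r addrC subrK mulf_neq0.
exists (lshift s i), (rshift r j).
exists ((t - 1) * coord B (lshift s i) x), ((t - 1) * coord B (rshift r j) x).
split; rewrite ?eq_lrshift ?nz // => l; rewrite !inE => /orP[] /eqP->;
  by rewrite !coord_bump ?eqxx ?eq_lrshift ?eq_rlshift ?mulr1 ?mulr0 ?addr0 ?nz'.
Qed.

(** At least two basis vectors remain besides those of [i] and [j]; adding either of them to [x]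
    leaves the coefficients [i] and [j] untouched, over any field. *)
Lemma dsg_triangulated_dim : (3 < r + s)%N -> triangulated G.
Proof.
move=> rs; apply: dsg_triangulated => x i j xi xj.
have /card_gt1P[k1 [k2 []]] : (1 < #|~: [set lshift s i; rshift r j]|)%N.
  by rewrite cardsCs setCK cards2 card_ord eq_lrshift ltn_subRL.
rewrite !inE !negb_or => /andP[k1i k1j] /andP[k2i k2j] k12.
exists k1, k2, 1, 1; split; rewrite ?oner_eq0 // => l; rewrite !inE !coord_bump.
case/orP=> /eqP->;
  by rewrite ?(negbTE k1i) ?(negbTE k2i) ?(negbTE k1j) ?(negbTE k2j) mulr0 addr0.
Qed.

End DirectSumCoefficients.

Lemma dsg_trivial (F : finFieldType) (V : vectType F) (U W : {vspace V})
    (alpha beta : 1.-tuple V) :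
    (U + W)%VS = fullv -> directv (U + W) ->
    basis_of U alpha -> basis_of W beta -> #|F| = 2%N ->
  trivial_graph (direct_sum_graph U W alpha beta).
Proof.
move=> hsum hdirect halpha hbeta F2.
have VP := dsg_verticesP hsum hdirect halpha hbeta.
(* Over two elements nonzero means equal to 1, so the only vertex is the sum of the two basis
   vectors. *)
set x : finvect_type V := \sum_(k < 1 + 1) 1 *: [tuple of alpha ++ beta]`_k.
have xG : x \in dsg_vertices U W.
  have cx k : coord [tuple of alpha ++ beta] k x = 1.
    by rewrite coord_sum_free // (basis_free (cat_basis_fullv hsum hdirect halpha hbeta)).
  by apply/VP; split; exists ord0; rewrite /alpha_coef /beta_coef cx oner_eq0.
rewrite /trivial_graph; apply: (@eq_card1 _ (Sub x xG)) => y; rewrite [LHS]/= !inE.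
symmetry; apply/eqP/val_inj; move: (val y) (valP y) => /= {}y.
case/VP => -[i yi] [j yj]; case/VP: xG => -[i' xi] [j' xj].
apply: (coef_inj hsum hdirect halpha hbeta) => k.
  by move: yi xi; rewrite !(ord1 i) !(ord1 i') !(ord1 k); apply: card2_eq_neq0.
by move: yj xj; rewrite !(ord1 j) !(ord1 j') !(ord1 k); apply: card2_eq_neq0.
Qed.

(* A vertex is determined by which of its two beta-coefficients vanish, and the
   vertices alpha + beta_0 and alpha + beta_1 are not adjacent. *)
Lemma dsg_no_cycle (F : finFieldType) (V : vectType F) (U W : {vspace V})
    (alpha : 1.-tuple V) (beta : 2.-tuple V) :
    (U + W)%VS = fullv -> directv (U + W) ->
    basis_of U alpha -> basis_of W beta -> #|F| = 2%N ->
  contains_no_cycle (direct_sum_graph U W alpha beta).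
Proof.
move=> hsum hdirect halpha hbeta F2.
set G := direct_sum_graph _ _ _ _.
pose b j (x : G) := beta_coef alpha beta (val x) j != 0.
have ord2 (j : 'I_2) : j = ord0 \/ j = ord_max.
  by case: j => [[|[|]]] // ?; [left|right]; apply: val_inj.
have VP := dsg_verticesP hsum hdirect halpha hbeta.
have b_neq0 x : b ord0 x || b ord_max x.
  case/VP: (valP x) => _ [j]; rewrite /b.
  by case: (ord2 j) => -> ->; rewrite ?orbT.
(* The single alpha-coefficient is nonzero in both vertices, hence equal; a beta-coefficient is
   known once it is known whether it vanishes. *)
have b_inj x y : b ord0 x = b ord0 y -> b ord_max x = b ord_max y -> x = y.
  move=> b0 b1; apply: val_inj; apply: (coef_inj hsum hdirect halpha hbeta) => k.
    case/VP: (valP x) (valP y) => -[i xi] _ /VP[[i' yi] _].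
    by move: xi yi; rewrite !(ord1 i) !(ord1 i') !(ord1 k); apply: card2_eq_neq0.
  have bk : b k x = b k y by case: (ord2 k) => ->.
  move: bk; rewrite /b.
  case: (eqVneq (beta_coef alpha beta (val x) k) 0) => [-> | xk].
    by move/esym/negPn/eqP->.
  by move/esym; apply: card2_eq_neq0.
have b_neq x y : x != y -> ~~ ((b ord0 x == b ord0 y) && (b ord_max x == b ord_max y)).
  by apply: contra => /andP[/eqP b0 /eqP b1]; apply/eqP/b_inj.
have b_adj x y : adj x y -> (b ord0 x && b ord0 y) || (b ord_max x && b ord_max y).
  case/and3P=> _ _ /existsP[j]; rewrite /b.
  by case: (ord2 j) => -> ->; rewrite ?orbT.
move=> c [/andP[]]; case: c => [|x [|y [|z [|t c]]]] //.
  (* A 3-cycle would use all three nonzero patterns of [b], two of which have disjoint supports and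
     so are not adjacent. *)
  move=> /and4P[xy yz zx _] /and4P[]; rewrite !inE negb_or => /andP[nxy nxz] nyz _ _ _.
  move: (b_neq0 x) (b_neq0 y) (b_neq0 z) (b_adj _ _ xy) (b_adj _ _ yz) (b_adj _ _ zx).
  move: (b_neq _ _ nxy) (b_neq _ _ nxz) (b_neq _ _ nyz).
  by do 6!case: (b _ _).
(* A longer cycle starts with four distinct vertices, but there are only three nonzero patterns. *)
move=> _ /= /and5P[]; rewrite !inE !negb_or => /and4P[nxy nxz nxt _].
move=> /and3P[nyz nyt _] /andP[nzt _] _ _ _.
move: (b_neq0 x) (b_neq0 y) (b_neq0 z) (b_neq0 t).
move: (b_neq _ _ nxy) (b_neq _ _ nxz) (b_neq _ _ nxt).
move: (b_neq _ _ nyz) (b_neq _ _ nyt) (b_neq _ _ nzt).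
by do 8!case: (b _ _).
Qed.

Theorem theorem3p5 (F : finFieldType) (V : vectType F) (q n r s : nat)
    (U W : {vspace V}) (alpha : r.-tuple V) (beta : s.-tuple V)
    (hq : #|F| = q) (hn : \dim {:V} = n)
    (hsum : (U + W)%VS = fullv) (hdirect : directv (U + W))
    (hU : U != 0%VS) (hW : W != 0%VS)
    (halpha : basis_of U alpha) (hbeta : basis_of W beta) :
  let G := direct_sum_graph U W alpha beta in
  [/\ (* (i) *)
      n = 2%N -> \dim W = (n - 1)%N -> q = 2%N -> trivial_graph G,
      (* (ii) *)
      n = 2%N -> \dim W = (n - 1)%N -> q <> 2%N -> triangulated G,
      (* (iii) *)
      n = 3%N -> \dim W = (n - 1)%N -> q = 2%N -> contains_no_cycle G
    & (* (iv) *)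
      n = 3%N -> \dim W = (n - 1)%N -> q <> 2%N -> triangulated G]
  /\ (* (v) *)
     ((4 <= n)%N -> \dim W = (n - 1)%N -> (2 <= q)%N -> triangulated G)
  /\ (* (vi) *)
     ((4 <= n)%N -> (\dim W <= n - 2)%N -> (2 <= q)%N -> triangulated G).
Proof.
move=> G.
have dimU := size_basis halpha; have dimW := size_basis hbeta.
have rs : (r + s)%N = n by rewrite -dimU -dimW -hn -hsum (directvP hdirect).
have tri_q : q <> 2%N -> triangulated G.
  move=> /eqP q2; apply: dsg_triangulated_card => //.
  by rewrite hq ltn_neqAle eq_sym q2 -hq; apply: finNzRing_gt1.
have tri_n : (4 <= n)%N -> triangulated G.
  by rewrite -rs; apply: dsg_triangulated_dim.
(* Subtraction on naturals is truncated, so [0 < n] is what lets [s = n - 1] give [r = 1]. *)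
have r1 : \dim W = (n - 1)%N -> (0 < n)%N -> r = 1%N.
  rewrite dimW -rs => s_eq n0; apply: (@addIn s); rewrite {2}s_eq.
  by rewrite subnKC.
split; last by split=> n4 *; apply: tri_n.
split=> n_eq W_eq; [ | by move=> /tri_q | | by move=> /tri_q] => q2;
  have r_eq : r = 1%N by (apply: r1; rewrite ?W_eq ?n_eq).
- have s_eq : s = 1%N by rewrite -dimW W_eq n_eq.
  (* With the dimension equations gone, [r] and [s] are replaced by numerals, so [alpha] and [beta]
     become tuples of literal length. *)
  by clear dimU dimW; subst r s; apply: dsg_trivial => //; rewrite hq.
- have s_eq : s = 2%N by rewrite -dimW W_eq n_eq.
  by clear dimU dimW; subst r s; apply: dsg_no_cycle => //; rewrite hq.
Qed.
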